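(* Let $(X_t)_{t\in\mathbb N}$ be a discrete-time Markov process with values in $\mathbb R$ and $X_0=x_0\in\mathbb R$ deterministic, let $f\colon\mathbb N\times\mathbb R\to\mathbb R$ be measurable, and let $S_t=\sum_{u=1}^t f(u,X_u)$ for $t\ge1$. Assume that there exist positive processes $C_t,\kappa_t,\sigma_t$ with $\kappa_t<1$ such that for each $t$, $C_t,\kappa_t,\sigma_t$ are bounded $\mathcal F_{t-1}$-measurable random variables and such that $$|X_t-X_{t-1}|\le C_t,\qquad t\ge1,$$ $$|P_{s,t}f(x)-P_{s,t}f(y)|\le\sigma_s(1-\kappa_s)^{t-s}|x-y|,\qquad x,y\in\mathbb R,\ 0\le s\le t.$$ Then for all $T\in\mathbb N$ with $T>0$ and all $R,a>0$, $$\mathbb P\left(S_T-\mathbb E S_T\ge R\ \text{ and }\ \sum_{t=1}^T\frac{\sigma_t^2C_t^2}{\kappa_t^2}\le a^2\right)\le\exp\left(-\frac{R^2}{8a^2}\right).$$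
   Context: $(\mathcal F_t)_{t\ge0}$ is the natural filtration of $X$ (and $\mathcal F_{-1}$ is taken to be trivial). For $0\le t\le u$ in $\mathbb N$, $P_{t,u}f(x)=\mathbb E[f(u,X_u)\mid X_t=x]$. *)

(* Defs.v *)
From HB Require Import structures.
From mathcomp Require Import all_boot all_order all_algebra.
From mathcomp Require Import all_classical all_reals all_analysis.
From mathcomp Require Import measurable_realfun.

Set Implicit Arguments.
Unset Strict Implicit.
Unset Printing Implicit Defensive.
Import Order.TTheory GRing.Theory Num.Theory.
Import numFieldNormedType.Exports.

Local Open Scope classical_set_scope.
Local Open Scope ring_scope.

Section defs.
Context (d : measure_display) (T : measurableType d) (R : realType).

(* [sigma_before X n] is generated by X_0, ..., X_{n-1}, so it is F_{n-1} for
   the natural filtration F; for n = 0 it is the trivial sigma-algebra F_{-1}. *)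
Definition sigma_before (X : nat -> T -> R) (n : nat) : set (set T) :=
  g_sigma_preimage (fun i : 'I_n => X i).

Definition natural_filtration (X : nat -> T -> R) (t : nat) : set (set T) :=
  sigma_before X t.+1.

Definition measurable_wrt (G : set (set T)) (Y : T -> R) : Prop :=
  measurable_fun [set: g_sigma_algebraType G] (Y : g_sigma_algebraType G -> R).

Variable P : probability T R.

(* Z is a version of P(A | G). *)
Definition is_cond_prob (G : set (set T)) (A : set T) (Z : T -> \bar R) : Prop :=
  measurable_fun [set: g_sigma_algebraType G]
    (Z : g_sigma_algebraType G -> \bar R) /\
  forall B, G B -> (\int[P]_(w in B) Z w)%E = P (A `&` B).

(* Every version of P(X_t \in A | sigma(X_s)) is a version of
   P(X_t \in A | F_s), where g_sigma_algebra_preimage (X s) is sigma(X_s). *)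
Definition markov_process (X : nat -> {RV P >-> R}) : Prop :=
  forall (s t : nat) (A : set R) (Z : T -> \bar R),
    (s <= t)%N -> measurable A ->
    is_cond_prob (g_sigma_algebra_preimage (X s)) (X t @^-1` A) Z ->
    is_cond_prob (natural_filtration X s) (X t @^-1` A) Z.

(* For s <= t, K s t x is the conditional law of X_t given X_s = x (a regular
   version of it, fixed by the choice of K). *)
Definition transition_kernels (X : nat -> {RV P >-> R})
    (K : nat -> nat -> R.-pker R ~> R) : Prop :=
  forall (s t : nat) (A : set R), (s <= t)%N -> measurable A ->
    is_cond_prob (g_sigma_algebra_preimage (X s)) (X t @^-1` A)
      (fun w => K s t (X s w) A).

(* P_{s,t} f (x) = E[f(t, X_t) | X_s = x], in the extended reals. The library
   integral of a non-integrable measurable function is +oo or -oo, and the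
   difference of two equal infinities is infinite too. So a finite bound on
   |P_{s,t} f (x) - P_{s,t} f (y)| for all x, y, hence for x = y, includes the
   integrability of f(t, _) for K s t x. *)
Definition transition_op (K : nat -> nat -> R.-pker R ~> R)
    (f : nat * R -> R) (s t : nat) (x : R) : \bar R :=
  (\int[K s t x]_y (f (t, y))%:E)%E.

(* Y t is measurable for F_{t-1}. *)
Definition bounded_predictable (X : nat -> T -> R) (Y : nat -> T -> R) : Prop :=
  forall t, measurable_wrt (sigma_before X t) (Y t) /\
    exists M : R, {ae P, forall w, `|Y t w| <= M}.

Definition additive_functional (f : nat * R -> R) (X : nat -> T -> R)
    (t : nat) (w : T) : R :=
  \sum_(1 <= u < t.+1) f (u, X u w).

End defs.

(* Main.v *)
Require Import Defs.
From HB Require Import structures.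
From mathcomp Require Import all_boot all_order all_algebra.
From mathcomp Require Import all_classical all_reals all_analysis.
From mathcomp Require Import measurable_realfun.
From mathcomp Require Import finmap zify ring lra.

Set Implicit Arguments.
Unset Strict Implicit.
Unset Printing Implicit Defensive.
Import Order.TTheory GRing.Theory Num.Theory.
Import numFieldNormedType.Exports.

Local Open Scope classical_set_scope.
Local Open Scope ring_scope.

(** The proof is the martingale method. Let [F_t] be the natural filtration
    and put [g s u x = E[f (u, X_u) | X_s = x]], so that the martingale
    [M_t = E[S_n | F_t]] is the sum over [1 <= u <= n] of
    [g (min t u) u (X_(min t u))]. Its last term is [S_n] and its first is the
    constant [E S_n], because [X_0] is deterministic.

    Its increments are controlled by the Lipschitz hypothesis. For [t < u] the
    variable [g (t+1) u (X_(t+1))] differs from [g (t+1) u (X_t)] by at most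
    [l = sigma C (1 - kappa)^(u - t - 1)], all processes being taken at [t+1].
    Now [g (t+1) u (X_t)] and [l] are known at time [t], while [g t u (X_t)]
    is the conditional expectation of [g (t+1) u (X_(t+1))] given [F_t];
    conditional expectation preserves the inequality ([cond_exp_close]), so
    [g t u (X_t)] also lies within [l] of [g (t+1) u (X_t)]. Hence the
    increment of the [u]-th term is at most [2 l], and after the geometric sum
    over [u] one gets [|M_(t+1) - M_t| <= 2 L_t] with
    [L_t <= sigma C / kappa].

    The conclusion is then the Azuma-Hoeffding inequality in the form where the
    bounds on the increments are predictable processes rather than constants
    ([azuma_predictable]): [P (M_n - M_0 >= r, sum c_t^2 <= b^2)] is at most
    [exp (- r^2 / (2 b^2))], applied to [c_t = 2 L_t] and [b = 2 a].

    Conditional expectations are never formed. They only enter through the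
    equality of integrals over the events of a sub-sigma-algebra, which extends
    to nonnegative weights measurable for it ([weighted_integral0]); for the
    Markov process these equalities come from integrating against the
    transition kernels ([ge0_integral_transition]). *)

(** * Hyperbolic and chord bounds for the exponential *)

Section cosh_bound.
Context {R : realType}.
Implicit Types x c d : R.

Lemma leq_expn2_fact n : (2 ^ n * n`! <= n.*2`!)%N.
Proof.
elim: n => // n IHn; rewrite doubleS [leqRHS]factS [in leqRHS]factS.
have -> : (2 ^ n.+1 * n.+1`! = n.*2.+2 * (2 ^ n * n`!))%N.
  by rewrite factS expnS -doubleS -mul2n; lia.
by rewrite leq_mul// (leq_trans IHn)// leq_pmull.
Qed.

(** The odd terms of the two series on the left cancel. *)
Lemma series_cosh_le x n :
  series (exp_coeff x) n.*2 + series (exp_coeff (- x)) n.*2 <=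
  2 * series (exp_coeff (x ^+ 2 / 2)) n.
Proof.
rewrite /series /=; elim: n => [|n IHn]; first by rewrite !big_geq// mulr0 addr0.
rewrite doubleS !big_nat_recr//= mulrDr.
set A := \sum_(_ <= _ < _) _ in IHn *; set B := \sum_(_ <= _ < _) _ in IHn *.
rewrite /exp_coeff/= !(exprS _ n.*2) -!mul2n !exprM sqrrN !mulNr expr_div_n.
set y := x ^+ 2; set a := y ^+ n.
suff : a / (2 * n)`!%:R <= a / 2 ^+ n / n`!%:R by lra.
have a0 : 0 <= a by rewrite exprn_ge0// sqr_ge0.
rewrite -mulrA -invfM ler_wpM2l//.
rewrite lef_pV2 ?posrE ?mulr_gt0 ?exprn_gt0 ?ltr0n ?fact_gt0//.
by rewrite -natrX -natrM ler_nat mul2n leq_expn2_fact.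
Qed.

(** Both sides are even power series, and the coefficient [1 / (2n)!] on the
    left is at most the coefficient [1 / (2 ^ n * n!)] on the right. *)
Lemma cosh_le_expR x : expR x + expR (- x) <= 2 * expR (x ^+ 2 / 2).
Proof.
have dbl : (fun n => n.*2) @ \oo --> \oo.
  move=> A [N _ NA]; exists N => // n /= Nn; apply: NA => /=.
  by rewrite (leq_trans Nn)// -addnn leq_addr.
have cv (y : R) : series (exp_coeff y) n.*2 @[n --> \oo] --> expR y.
  exact: (cvg_comp _ _ dbl (is_cvg_series_exp_coeff y)).
have cvl : series (exp_coeff x) n.*2 + series (exp_coeff (- x)) n.*2
    @[n --> \oo] --> expR x + expR (- x) by exact: cvgD.
have cvr : 2 * series (exp_coeff (x ^+ 2 / 2)) n
    @[n --> \oo] --> 2 * expR (x ^+ 2 / 2).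
  by apply: cvgM; [exact: cvg_cst|exact: is_cvg_series_exp_coeff].
rewrite -(cvg_lim _ cvl)// -(cvg_lim _ cvr)//.
apply: ler_lim; [by apply/cvg_ex; eexists; exact: cvl|
  by apply/cvg_ex; eexists; exact: cvr|].
by apply: nearW => n; exact: series_cosh_le.
Qed.

(** Convexity: [d] is the barycentre of [c] and [- c] with weights
    [(c + d) / (2 * c)] and [(c - d) / (2 * c)]. *)
Lemma expR_le_chord c d : 0 < c -> `|d| <= c ->
  expR d <= (expR c + expR (- c)) / 2 + d * ((expR c - expR (- c)) / 2 / c).
Proof.
move=> c0; rewrite ler_norml => /andP[cd dc].
have t0 : 0 <= (c + d) / (2 * c) by rewrite divr_ge0//; lra.
have t1 : (c + d) / (2 * c) <= 1 by rewrite ler_pdivrMr; lra.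
have := convex_expR (Itv01 t0 t1) c (- c); rewrite !convRE /= /unstable.onem.
have -> : (c + d) / (2 * c) * c + (1 - (c + d) / (2 * c)) * - c = d.
  by field; rewrite gt_eqF.
by move=> /le_trans; apply; rewrite le_eqVlt; apply/orP; left; apply/eqP;
  field; rewrite gt_eqF.
Qed.

(** The slope [sinh c / c] of the chord over [[-c, c]], times the damping factor
    [exp (- c^2 / 2)]. It is named because it becomes a weight that depends on
    the past only. *)
Definition chord_slope c :=
  (expR c - expR (- c)) / 2 / c * expR (- (c ^+ 2 / 2)).

Lemma chord_slope_ge0 c : 0 <= chord_slope c.
Proof.
rewrite /chord_slope mulr_ge0 ?expR_ge0//.
have [c0|c0] := leP 0 c.
  by rewrite !divr_ge0// subr_ge0 ler_expR; lra.
have h : expR c - expR (- c) <= 0 by rewrite subr_le0 ler_expR; lra.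
by apply: mulr_le0; rewrite ?invr_le0 ?(ltW c0)//; lra.
Qed.

(** Hoeffding's lemma before taking expectations: the chord bound has constant
    term [cosh c], which the factor [exp (- c^2 / 2)] brings below [1], and its
    linear term vanishes on average when [d] is a martingale increment. *)
Lemma expR_damped_le c d : `|d| <= c ->
  expR (d - c ^+ 2 / 2) <= 1 + d * chord_slope c.
Proof.
(* For [c = 0] the slope is [0] since [0^-1 = 0], and [d = 0] as well. *)
move=> dc; have := le_trans (normr_ge0 d) dc.
rewrite le_eqVlt => /orP[/eqP c0|c0].
  move: dc; rewrite -c0 normr_le0 => /eqP ->.
  by rewrite mul0r addr0 expr0n/= mul0r subr0 expR0.
have h := expR_le_chord c0 dc; have k := cosh_le_expR c.
rewrite /chord_slope expRD.
set s := (expR c - expR (- c)) / 2 / c in h *.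
set e := expR (- (c ^+ 2 / 2)).
have e1 : expR (c ^+ 2 / 2) * e = 1 by rewrite /e expRN divff// gt_eqF// expR_gt0.
have -> : 1 + d * (s * e) = (expR (c ^+ 2 / 2) + d * s) * e.
  by rewrite mulrDl e1 mulrA.
by rewrite ler_wpM2r ?expR_ge0//; lra.
Qed.

Lemma chord_slope_bound c d : `|d| <= c -> `|d * chord_slope c| <= expR c.
Proof.
move=> dc; have := le_trans (normr_ge0 d) dc.
rewrite le_eqVlt => /orP[/eqP c0|c0].
  by rewrite /chord_slope -c0 invr0 mulr0 mul0r mulr0 normr0 expR_ge0.
rewrite normrM (ger0_norm (chord_slope_ge0 c)) /chord_slope.
have -> : `|d| * ((expR c - expR (- c)) / 2 / c * expR (- (c ^+ 2 / 2))) =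
  `|d| / c * ((expR c - expR (- c)) / 2) * expR (- (c ^+ 2 / 2)).
  by field; rewrite gt_eqF.
have e1 : expR (- (c ^+ 2 / 2)) <= 1.
  by rewrite -[leRHS]expR0 ler_expR; have := sqr_ge0 c; lra.
have e2 : `|d| / c <= 1 by rewrite ler_pdivrMr// mul1r.
have e3 : 0 <= `|d| / c by rewrite divr_ge0// ltW.
have e4 : 0 <= (expR c - expR (- c)) / 2.
  by rewrite divr_ge0// subr_ge0 ler_expR; lra.
have e5 : (expR c - expR (- c)) / 2 <= expR c.
  by have := expR_ge0 (- c); have := expR_ge0 c; lra.
have e6 : `|d| / c * ((expR c - expR (- c)) / 2) <= 1 * expR c by exact: ler_pM.
rewrite mul1r in e6.
by rewrite -[leRHS]mulr1; apply: ler_pM => //; rewrite mulr_ge0.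
Qed.

End cosh_bound.

(** * Integration against sub-sigma-algebras *)

Section ge0_measurable_ind.
Context d (T : measurableType d) (R : realType).
Import HBNNSimple.
Local Open Scope ereal_scope.

(** Functional induction on nonnegative measurable functions: the class generated
    by indicators under nonnegative combinations and increasing limits contains
    all of them. It is used for identities between two integrals that are both
    additive and monotonically continuous in an integrand. *)
Lemma ge0_measurable_ind (Q : (T -> \bar R) -> Prop) :
    Q (cst 0) ->
    (forall (r : R) (A : set T) (g : T -> \bar R), (0 <= r)%R -> measurable A ->
      measurable_fun setT g -> (forall x, 0 <= g x) -> Q g ->
      Q (fun x => r%:E * (\1_A x)%:E + g x)) ->
    (forall g : (T -> \bar R)^nat, (forall n, measurable_fun setT (g n)) ->
      (forall n x, 0 <= g n x) ->
      (forall x, {homo g ^~ x : m n / (m <= n)%N >-> m <= n}) ->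
      (forall n, Q (g n)) -> Q (fun x => limn (g ^~ x))) ->
  forall f, measurable_fun setT f -> (forall x, 0 <= f x) -> Q f.
Proof.
move=> Q0 QD Qlim f mf f0.
have Qsum (h : {nnsfun T >-> R}) (s : seq R) :
    (forall y, y \in s -> (0 <= y)%R) ->
    let g x := \sum_(y <- s) y%:E * (\1_(h @^-1` [set y]) x)%:E in
    [/\ measurable_fun setT g, (forall x, 0 <= g x) & Q g].
  elim: s => [|y s IHs] s0 /=.
    under eq_fun do rewrite big_nil.
    by split => // x; rewrite big_nil.
  have [|mg g0 Qg] := IHs.
    by move=> z zs; rewrite s0// inE zs orbT.
  have y0 : (0 <= y)%R by rewrite s0// mem_head.
  under eq_fun do rewrite big_cons.
  split.
  - apply: emeasurable_funD => //; apply: emeasurable_funM => //.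
    exact/measurable_EFinP.
  - by move=> x; rewrite big_cons adde_ge0// mule_ge0// lee_fin.
  - exact: QD.
have Qh (h : {nnsfun T >-> R}) : Q (EFin \o h).
  have -> : EFin \o h = fun x =>
      \sum_(y <- fset_set (range h)) y%:E * (\1_(h @^-1` [set y]) x)%:E.
    apply/funext => x /=; rewrite fimfunE fsbig_finite//= sumEFin.
    by [].
  by have [y|//] := Qsum h (fset_set (range h)); rewrite in_fset_set//;
    move=> /set_mem[x _ <-].
pose f_ := nnsfun_approx measurableT mf.
have -> : f = fun x => limn ((fun n => EFin \o f_ n) ^~ x).
  by apply/funext => x; apply/esym/cvg_lim => //; exact: cvg_nnsfun_approx.
apply: Qlim => //.
- by move=> n; exact/measurable_EFinP.
- by move=> n x; rewrite lee_fin.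
- by move=> x m n mn; exact/lefP/nd_nnsfun_approx.
Qed.

End ge0_measurable_ind.

Section sub_sigma_algebra.
Context d (T : measurableType d) (R : realType) (P : probability T R).
Implicit Types (F G : set (set T)) (Y W U : T -> R).

Lemma measurable_wrtS F G Y : F `<=` G ->
  measurable_wrt F Y -> measurable_wrt G Y.
Proof.
move=> FG mY _ B mB; have := mY measurableT B mB; rewrite !setTI.
apply: (@sub_smallest2r _ (sigma_algebra setT)) => //.
Qed.

Lemma measurable_sub_sigma d' (T' : measurableType d') F
    (Y : g_sigma_algebraType F -> T') : F `<=` measurable ->
  measurable_fun [set: g_sigma_algebraType F] Y ->
  measurable_fun [set: T] (Y : T -> T').
Proof.
move=> Fm mY _ B mB; have := mY measurableT B mB; rewrite !setTI.
by apply: smallest_sub => //; exact: sigma_algebra_measurable.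
Qed.

Lemma measurable_wrt_preimage F Y (B : set R) : sigma_algebra setT F ->
  measurable_wrt F Y -> measurable B -> F (Y @^-1` B).
Proof.
move=> sF mY mB; have := mY measurableT B mB.
by rewrite setTI /measurable/= sigma_algebra_id.
Qed.

(** The equality of the two halves of the integral, unlike the vanishing of their
    difference, is stable under increasing limits of weights. *)
Lemma integral_funeposneg_eq (Y : T -> \bar R) (A : set T) : measurable A ->
  P.-integrable setT Y -> (\int[P]_(x in A) Y x = 0)%E ->
  (\int[P]_(x in A) Y^\+ x = \int[P]_(x in A) Y^\- x)%E.
Proof.
move=> mA iY; have iYA : P.-integrable A Y by exact: integrableS iY.
rewrite integralE => /eqP; rewrite sube_eq ?add0e => [/eqP//||].
  exact: integrable_pos_fin_num.
by rewrite fin_num_adde_defl// integrable_neg_fin_num.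
Qed.

Local Open Scope ereal_scope.

(** This is [E[W Y] = E[W E[Y | F]]] when [E[Y | F] = 0]. The identity
    [E[W Y^+] = E[W Y^-]] holds for indicators of events of [F], and passes to
    any nonnegative weight by functional induction over [F]-measurable
    functions. *)
Lemma weighted_integral0 F Y W : sigma_algebra setT F -> F `<=` measurable ->
    measurable_wrt F W -> (forall x, (0 <= W x)%R) ->
    P.-integrable setT (EFin \o Y) ->
    (forall B, F B -> \int[P]_(x in B) (Y x)%:E = 0) ->
    P.-integrable setT (fun x => (W x * Y x)%:E) ->
  \int[P]_x (W x * Y x)%:E = 0.
Proof.
move=> sF Fm mW W0 iY Y0 iWY.
have mY : measurable_fun setT (EFin \o Y) := measurable_int P iY.
set Yp := (EFin \o Y)^\+; set Yn := (EFin \o Y)^\-.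
have mYp : measurable_fun setT Yp by exact: measurable_funepos.
have mYn : measurable_fun setT Yn by exact: measurable_funeneg.
have Yp0 x : 0 <= Yp x by exact: funepos_ge0.
have Yn0 x : 0 <= Yn x by exact: funeneg_ge0.
pose Q (w : g_sigma_algebraType F -> \bar R) :=
  \int[P]_x (w x * Yp x) = \int[P]_x (w x * Yn x).
have integralD1 (r : R) (A : set T) (w Z : T -> \bar R) : (0 <= r)%R ->
    measurable A -> measurable_fun setT w -> (forall x, 0 <= w x) ->
    measurable_fun setT Z -> (forall x, 0 <= Z x) ->
    \int[P]_x ((r%:E * (\1_A x)%:E + w x) * Z x) =
    r%:E * \int[P]_(x in A) Z x + \int[P]_x (w x * Z x).
  move=> r0 mA mw w0 mZ Z0.
  under eq_integral.
    move=> x _; rewrite ge0_muleDl ?mule_ge0 ?lee_fin// -muleA.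
    over.
  have mAZ : measurable_fun setT (fun x => (\1_A x)%:E * Z x).
    by apply: emeasurable_funM => //; exact/measurable_EFinP.
  rewrite ge0_integralD//.
  - rewrite ge0_integralZl_EFin//.
      rewrite [in RHS]integral_mkcond; congr (_ * _ + _).
      by apply: eq_integral => x _; rewrite epatch_indic muleC.
    by move=> x _; rewrite mule_ge0// lee_fin.
  - by move=> x _; rewrite !mule_ge0// lee_fin.
  - exact: measurable_funeM.
  - by move=> x _; rewrite mule_ge0.
  - exact: emeasurable_funM.
have integral_lim (g : (T -> \bar R)^nat) (Z : T -> \bar R) :
    (forall n, measurable_fun setT (g n)) ->
    (forall n x, 0 <= g n x) ->
    (forall x, {homo g ^~ x : m n / (m <= n)%N >-> m <= n}) ->
    measurable_fun setT Z -> (forall x, 0 <= Z x) ->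
    (forall x, Z x \is a fin_num) ->
    \int[P]_x (limn (g ^~ x) * Z x) = limn (fun n => \int[P]_x (g n x * Z x)).
  move=> mg g0 ndg mZ Z0 Zfin; rewrite -monotone_convergence//.
  - apply: eq_integral => x _; apply/esym/cvg_lim => //.
    by apply: cvgeZr => //; exact/ereal_nondecreasing_is_cvgn.
  - by move=> n; apply: emeasurable_funM => //; exact/measurable_EFinP.
  - by move=> n x _; rewrite mule_ge0.
  - by move=> x _ m n mn; rewrite lee_wpmul2r// ndg.
have Ypfin x : Yp x \is a fin_num by rewrite /Yp funerpos.
have Ynfin x : Yn x \is a fin_num by rewrite /Yn funerneg.
have QW : Q (EFin \o W).
  apply: (ge0_measurable_ind (Q := Q)).
  - by rewrite /Q; under eq_integral do rewrite mul0e;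
      under [RHS]eq_integral do rewrite mul0e.
  - move=> r A g r0 mA mg g0; rewrite /Q => Qg.
    have FA : F A by move: mA; rewrite /measurable/= sigma_algebra_id.
    have mg' := measurable_sub_sigma Fm mg.
    rewrite !integralD1//; [|exact: Fm..]; congr (_ * _ + _).
      by apply: integral_funeposneg_eq => //; [exact: Fm|exact: Y0].
    exact: Qg.
  - move=> g mg g0 ndg Qg; rewrite /Q.
    have mg' n : measurable_fun setT (g n : T -> \bar R).
      exact: measurable_sub_sigma (mg n).
    rewrite !integral_lim//; congr (limn _).
    by apply/funext => n; exact: Qg.
  - exact/measurable_EFinP.
  - by move=> x; rewrite lee_fin.
rewrite integralE.
have posE : \int[P]_x (fun x => (W x * Y x)%:E)^\+ x =
    \int[P]_x ((W x)%:E * Yp x).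
  apply: eq_integral => x _; rewrite /Yp !funeposE /=.
  by rewrite EFinM maxe_pMr ?lee_fin// mule0.
have negE : \int[P]_x (fun x => (W x * Y x)%:E)^\- x =
    \int[P]_x ((W x)%:E * Yn x).
  apply: eq_integral => x _; rewrite /Yn !funenegE /=.
  by rewrite maxe_pMr ?lee_fin// mule0 -EFinM mulrN.
rewrite posE [X in X - _]QW -negE subee//.
exact: integrable_neg_fin_num.
Qed.

(** The event where [Y] is negative belongs to [F], so [Y] has a nonnegative
    integral over it, which forces it to be null. *)
Lemma ae_ge0_of_integral F Y : sigma_algebra setT F -> F `<=` measurable ->
    measurable_wrt F Y -> P.-integrable setT (EFin \o Y) ->
    (forall B, F B -> 0 <= \int[P]_(x in B) (Y x)%:E) ->
  {ae P, forall x, (0 <= Y x)%R}.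
Proof.
move=> sF Fm mY iY Y0; set B := Y @^-1` `]-oo, 0%R[%classic.
have FB : F B by apply: measurable_wrt_preimage => //; exact: measurable_itv.
have mB : measurable B by exact: Fm.
have iYB : P.-integrable B (EFin \o Y) by exact: integrableS iY.
have BE x : B x = (Y x < 0)%R by rewrite /B/= in_itv.
have absE : \int[P]_(x in B) `|(Y x)%:E| = - \int[P]_(x in B) (Y x)%:E.
  rewrite -integralN ?fin_num_adde_defl ?fin_numN ?integrable_neg_fin_num//.
  apply: eq_integral => x /set_mem; rewrite BE => Yx.
  by rewrite /= ler0_norm// ltW.
have /(ae_eq_integral_abs P mB (measurable_int P iYB)) : 
    \int[P]_(x in B) `|(EFin \o Y) x| = 0.
  apply/eqP; rewrite eq_le integral_ge0// andbT /=.
  by rewrite absE oppe_le0 Y0.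
apply: filterS => x h; rewrite leNgt; apply/negP => Yx.
by have := h; rewrite BE => /(_ Yx) []; apply/eqP; rewrite lt_eqF.
Qed.

End sub_sigma_algebra.

(** * Azuma-Hoeffding inequality with predictable bounds *)

(** Away from [0] the inverse is [x * (x^2)^-1], and a negative power of the
    nonnegative number [x^2] is a real power; the identity persists at [0]. *)
Lemma measurable_invr (R : realType) :
  measurable_fun [set: R] (fun x : R => x^-1).
Proof.
have -> : (fun x : R => x^-1) = (fun x => x * (x ^+ 2) `^ (-1)).
  apply/funext => x; rewrite powR_inv1 ?sqr_ge0// expr2.
  have [->|x0] := eqVneq x 0; first by rewrite invr0 mul0r.
  by rewrite invfM mulrA divff// mul1r.
apply: measurable_funM => //.
exact: (measurableT_comp (measurable_powR _) (exprn_measurable 2)).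
Qed.

Section azuma.
Context d (T : measurableType d) (R : realType) (P : probability T R).

Lemma ae_bounded_integrable (f : T -> R) : measurable_fun setT f ->
  (exists K : R, {ae P, forall x, `|f x| <= K}) -> P.-integrable setT (EFin \o f).
Proof.
move=> mf [K fK]; apply/integrableP; split; first exact/measurable_EFinP.
apply: (@le_lt_trans _ _ (\int[P]_x (cst `|K|%:E) x)%E); last first.
  rewrite integral_cst//. by rewrite ltey_eq fin_numM// fin_num_measure.
apply: ae_ge0_le_integral => //.
- by apply: measurableT_comp => //; exact/measurable_EFinP.
- by move=> x _; rewrite lee_fin.
- apply: filterS fK => x fK _.
  by rewrite /= lee_fin (le_trans fK)// ler_norm.
Qed.

Lemma ae_le_integral (A : set T) (f g : T -> R) : measurable A ->
    P.-integrable A (EFin \o f) -> P.-integrable A (EFin \o g) ->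
    {ae P, forall x, f x <= g x} ->
  (\int[P]_(x in A) (f x)%:E <= \int[P]_(x in A) (g x)%:E)%E.
Proof.
move=> mA fi gi fg; rewrite -sube_ge0; last first.
  by rewrite (integrable_fin_num mA fi).
rewrite -integralB//.
have igf : P.-integrable A ((EFin \o g) \- (EFin \o f))%E by exact: integrableB.
rewrite (ae_eq_integral (fun x => `|((EFin \o g) \- (EFin \o f)) x|)%E)//.
- by apply: integral_ge0 => x _; exact: abse_ge0.
- exact: measurable_int igf.
- by apply: measurableT_comp => //; exact: measurable_int igf.
- by apply: filterS fg => x fg _; rewrite /= ger0_norm// subr_ge0.
Qed.

Variables (F : nat -> set (set T)) (M c : nat -> T -> R).
Hypotheses (sF : forall t, sigma_algebra setT (F t))
  (Fm : forall t, F t `<=` measurable) (ndF : forall t, F t `<=` F t.+1)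
  (mM : forall t, measurable_wrt (F t) (M t))
  (iM : forall t, P.-integrable setT (EFin \o M t))
  (martM : forall t B, F t B ->
    (\int[P]_(x in B) (M t.+1 x)%:E = \int[P]_(x in B) (M t x)%:E)%E)
  (mc : forall t, measurable_wrt (F t) (c t))
  (bc : forall t, exists K : R, {ae P, forall x, `|c t x| <= K})
  (incrM : forall t, {ae P, forall x, `|M t.+1 x - M t x| <= c t x}).

Let mM' t : measurable_fun setT (M t).
Proof. exact: (measurable_sub_sigma (@Fm t) (@mM t)). Qed.

Let mc' t : measurable_fun setT (c t).
Proof. exact: (measurable_sub_sigma (@Fm t) (@mc t)). Qed.

Lemma measurable_wrt_le s t (Y : T -> R) : (s <= t)%N ->
  measurable_wrt (F s) Y -> measurable_wrt (F t) Y.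
Proof.
move=> st; apply: measurable_wrtS.
elim: t st => [|t IHt]; first by rewrite leqn0 => /eqP ->.
by rewrite leq_eqVlt ltnS => /orP[/eqP ->//|/IHt /subset_trans]; apply.
Qed.

(** The compensated exponential, a supermartingale by Hoeffding's lemma. *)
Definition exp_mart (l : R) n x :=
  expR (l * (M n x - M 0%N x) - \sum_(0 <= t < n) (l * c t x) ^+ 2 / 2).

Lemma exp_martS l n x : exp_mart l n.+1 x =
  exp_mart l n x * expR (l * (M n.+1 x - M n x) - (l * c n x) ^+ 2 / 2).
Proof.
by rewrite /exp_mart -expRD big_nat_recr//=; congr expR; ring.
Qed.

Lemma measurable_exp_mart l n : measurable_wrt (F n) (exp_mart l n).
Proof.
rewrite /measurable_wrt; apply: measurableT_comp; first exact: measurable_expR.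
apply: measurable_funB.
  apply: measurable_funM => //; apply: measurable_funB; first exact: mM.
  exact: (measurable_wrt_le (leq0n n) (@mM 0%N)).
have : forall m, (m <= n)%N -> measurable_wrt (F n)
    (fun x => \sum_(0 <= t < m) (l * c t x) ^+ 2 / 2).
  elim=> [_|m IHm mn]; rewrite /measurable_wrt.
    by under eq_fun do rewrite big_geq//; exact: measurable_cst.
  under eq_fun do rewrite big_nat_recr//=.
  apply: measurable_funD; first exact: (IHm (ltnW mn)).
  apply: measurable_funM => //; apply: measurable_funX.
  by apply: measurable_funM => //; exact: (measurable_wrt_le (ltnW mn) (@mc m)).
exact.
Qed.

(** Boundedness of each [c t] is what makes all the integrals below finite. *)
Lemma exp_mart_bounded l n : 0 < l ->
  exists K : R, {ae P, forall x, `|exp_mart l n x| <= K}.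
Proof.
move=> l0; elim: n => [|n [K IHn]].
  exists 1; apply: aeW => x; rewrite /exp_mart big_geq// subrr mulr0 subr0.
  by rewrite expR0 normr1.
have [L cL] := bc n; exists (K * expR (l * L)).
apply: filterS3 IHn cL (incrM n) => x xK xL xc.
rewrite exp_martS normrM ler_pM// ger0_norm ?expR_ge0// ler_expR.
have h : M n.+1 x - M n x <= L.
  by rewrite (le_trans (ler_norm _))// (le_trans xc)// (le_trans (ler_norm _)).
have k := sqr_ge0 (l * c n x).
have : l * (M n.+1 x - M n x) <= l * L by rewrite ler_pM2l.
lra.
Qed.

Let measurable_exp_mart' l n : measurable_fun setT (exp_mart l n).
Proof. exact: (measurable_sub_sigma (@Fm n) (@measurable_exp_mart l n)). Qed.

Lemma exp_mart_integrable l n : 0 < l ->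
  P.-integrable setT (EFin \o exp_mart l n).
Proof.
by move=> l0; apply: ae_bounded_integrable => //; exact: exp_mart_bounded.
Qed.

(** One step multiplies the compensated exponential by at most
    [1 + l D s], where [D] is the martingale increment and [s] a damped chord
    slope; as [exp_mart l n * s * l] depends on the past only, the linear term
    integrates to [0]. *)
Lemma exp_mart_integral_le1 l n : 0 < l ->
  (\int[P]_x (exp_mart l n x)%:E <= 1)%E.
Proof.
move=> l0; elim: n => [|n IHn].
  under eq_integral do
    rewrite /exp_mart big_geq// subrr mulr0 subr0 expR0.
  by rewrite integral_cst// mul1e probability_le1.
pose W x := exp_mart l n x * chord_slope (l * c n x) * l.
pose D x := M n.+1 x - M n x.
have iD : P.-integrable setT (EFin \o D).
  rewrite /D (_ : _ \o _ = (EFin \o M n.+1) \- (EFin \o M n))%E//.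
  exact: integrableB.
have mD : measurable_fun setT D by exact: measurable_funB.
have mW : measurable_wrt (F n) W.
  apply: measurable_funM => //; apply: measurable_funM.
    exact: measurable_exp_mart.
  rewrite /chord_slope.
  have mlc : measurable_fun [set: g_sigma_algebraType (F n)] (fun x => l * c n x).
    by apply: measurable_funM => //; exact: (@mc n).
  have mexp (h : g_sigma_algebraType (F n) -> R) : measurable_fun setT h ->
      measurable_fun setT (fun x => expR (h x)).
    by move=> mh; apply: measurableT_comp => //; exact: measurable_expR.
  apply: measurable_funM.
    apply: measurable_funM.
      apply: measurable_funM => //; apply: measurable_funB; first exact: mexp.
      by apply: mexp; exact: measurable_funN.
    exact: (measurableT_comp (@measurable_invr R) mlc).
  apply: mexp; apply: measurable_funN; apply: measurable_funM => //.
  exact: measurable_funX.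
have mW' : measurable_fun setT W by exact: (measurable_sub_sigma (@Fm n) mW).
have iWD : P.-integrable setT (fun x => (W x * D x)%:E).
  have [K bK] := exp_mart_bounded n l0; have [L bL] := bc n.
  apply: ae_bounded_integrable; first exact: measurable_funM.
  exists (K * expR (l * L)); apply: filterS3 bK bL (incrM n) => x xK xL xc.
  rewrite /W -2!mulrA normrM ler_pM// (mulrC (chord_slope _)).
  have h : `|l * D x| <= l * c n x by rewrite normrM gtr0_norm// ler_pM2l.
  rewrite (le_trans (chord_slope_bound h))// ler_expR ler_pM2l//.
  by rewrite (le_trans (ler_norm _)).
have WD0 : (\int[P]_x (W x * D x)%:E = 0)%E.
  apply: (weighted_integral0 (@sF n) (@Fm n)) => //.
    by move=> x; rewrite /W mulr_ge0 ?(ltW l0)// mulr_ge0 ?expR_ge0 ?chord_slope_ge0.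
  move=> B FB; rewrite /D; under eq_integral do rewrite EFinB.
  have mB : measurable B by exact: Fm FB.
  rewrite integralB//=; [|exact: integrableS (iM _)|exact: integrableS (iM _)].
  rewrite martM// subee//; apply: integrable_fin_num => //.
  exact: integrableS (iM _).
have -> : (1 = 1 + \int[P]_x (W x * D x)%:E :> \bar R)%E by rewrite WD0 adde0.
apply: (@le_trans _ _ (\int[P]_x ((exp_mart l n x)%:E + (W x * D x)%:E))%E).
  apply: (ae_le_integral (g := fun x => exp_mart l n x + W x * D x)) => //.
  - exact: exp_mart_integrable.
  - exact: (integrableD measurableT (exp_mart_integrable n l0) iWD).
  - apply: filterS (incrM n) => x xc; rewrite exp_martS /=.
    have -> : exp_mart l n x + W x * D x =
        exp_mart l n x * (1 + l * D x * chord_slope (l * c n x)).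
      by rewrite /W; ring.
    rewrite ler_wpM2l ?expR_ge0//; apply: expR_damped_le.
    by rewrite normrM gtr0_norm// ler_pM2l.
rewrite integralD//; first by rewrite leeD2r.
exact: exp_mart_integrable.
Qed.

(** Markov's inequality for the compensated exponential: on the event, it is at
    least [exp (l r - l^2 b^2 / 2)], whatever the values of the individual bounds
    [c t]; the choice [l = r / b^2] maximizes this value. *)
Lemma azuma_predictable n (r b : R) : 0 < r -> 0 < b ->
  (P [set x | (r <= M n x - M 0%N x)%R /\
     (\sum_(0 <= t < n) c t x ^+ 2 <= b ^+ 2)%R] <=
   (expR (- (r ^+ 2 / (2 * b ^+ 2))))%:E)%E.
Proof.
move=> r0 b0; set E := [set x | _].
have mE : measurable E.
  apply: measurableI.
    rewrite -[X in measurable X]setTI; apply: measurable_fun_ler => //.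
    exact: measurable_funB.
  rewrite -[X in measurable X]setTI; apply: measurable_fun_ler => //.
  by apply: measurable_sum => t; exact: measurable_funX.
pose l := r / b ^+ 2.
have b20 : 0 < b ^+ 2 by rewrite exprn_gt0.
have l0 : 0 < l by rewrite divr_gt0.
set e := r ^+ 2 / (2 * b ^+ 2).
have WE x : E x -> expR e <= exp_mart l n x.
  move=> [rM sc]; rewrite ler_expR.
  have -> : \sum_(0 <= t < n) (l * c t x) ^+ 2 / 2 =
      l ^+ 2 / 2 * \sum_(0 <= t < n) c t x ^+ 2.
    by rewrite mulr_sumr; apply: eq_bigr => t _; ring.
  have h1 : l * r <= l * (M n x - M 0%N x) by rewrite ler_pM2l.
  have h2 : l ^+ 2 / 2 * \sum_(0 <= t < n) c t x ^+ 2 <= l ^+ 2 / 2 * b ^+ 2.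
    by rewrite ler_wpM2l// divr_ge0// sqr_ge0.
  have -> : e = l * r - l ^+ 2 / 2 * b ^+ 2.
    by rewrite /e /l; field; rewrite gt_eqF.
  exact: lerB.
rewrite expRN -[leRHS]mule1 lee_pdivlMl ?expR_gt0//.
apply: le_trans (exp_mart_integral_le1 n l0).
apply: (@le_trans _ _ (\int[P]_(x in E) (exp_mart l n x)%:E)%E).
  rewrite -integral_cst//; apply: ge0_le_integral => //.
  - by move=> x _; rewrite /= lee_fin expR_ge0.
  - by apply/measurable_EFinP; exact: measurable_funTS.
apply: ge0_subset_integral => //; first exact/measurable_EFinP.
by move=> x _; rewrite /= lee_fin expR_ge0.
Qed.

End azuma.

(** * Almost sure comparison through conditional integrals *)

Section conditional_comparison.
Context d (T : measurableType d) (R : realType) (P : probability T R).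
Variable F : set (set T).
Hypotheses (sF : sigma_algebra setT F) (Fm : F `<=` measurable).

Lemma ae_le_of_integral (Z1 Z2 : T -> R) :
    measurable_wrt F Z1 -> measurable_wrt F Z2 ->
    P.-integrable setT (EFin \o Z1) -> P.-integrable setT (EFin \o Z2) ->
    (forall B, F B ->
      (\int[P]_(x in B) (Z1 x)%:E <= \int[P]_(x in B) (Z2 x)%:E)%E) ->
  {ae P, forall x, Z1 x <= Z2 x}.
Proof.
move=> mZ1 mZ2 iZ1 iZ2 Z12.
have : {ae P, forall x, 0 <= Z2 x - Z1 x}.
  apply: (@ae_ge0_of_integral _ _ _ P F (fun x => Z2 x - Z1 x)) => //.
  - exact: measurable_funB.
  - exact: (integrableB measurableT iZ2 iZ1).
  - move=> B FB; have mB : measurable B by exact: Fm.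
    have iB (Z : T -> R) : P.-integrable setT (EFin \o Z) ->
        P.-integrable B (EFin \o Z) by exact: integrableS.
    under eq_integral do rewrite EFinB.
    rewrite integralB//; [|exact: iB|exact: iB].
    by rewrite sube_ge0 ?Z12// (integrable_fin_num mB (iB _ iZ1)).
by apply: filterS => x; rewrite subr_ge0.
Qed.

(** Think of [Z] as [E[Y | F]]: if [Y] lies in the interval of centre [V] and
    radius [l], both known to [F], then so does its conditional expectation. *)
Lemma cond_exp_close (Y Z V l : T -> R) :
    measurable_wrt F Z -> measurable_wrt F V -> measurable_wrt F l ->
    P.-integrable setT (EFin \o Y) -> P.-integrable setT (EFin \o Z) ->
    (forall B, F B ->
      (\int[P]_(x in B) (Z x)%:E = \int[P]_(x in B) (Y x)%:E)%E) ->
    (exists K : R, {ae P, forall x, `|l x| <= K}) ->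
    {ae P, forall x, `|Y x - V x| <= l x} ->
  {ae P, forall x, `|Z x - V x| <= l x}.
Proof.
move=> mZ mV ml iY iZ ZY [K lK] YV.
have mY : measurable_fun setT Y by exact/measurable_EFinP/(measurable_int P).
have mV' : measurable_fun setT V := measurable_sub_sigma Fm mV.
have ml' : measurable_fun setT l := measurable_sub_sigma Fm ml.
have il : P.-integrable setT (EFin \o l).
  by apply: ae_bounded_integrable => //; exists K.
have iYV : P.-integrable setT (EFin \o (fun x => Y x - V x)).
  apply: ae_bounded_integrable; first exact: measurable_funB.
  exists K; apply: filterS2 YV lK => x YV lK.
  by rewrite (le_trans YV)// (le_trans (ler_norm _)).
have iV : P.-integrable setT (EFin \o V).
  rewrite (_ : _ \o _ = (EFin \o Y) \- (EFin \o (fun x => (Y x - V x)%R)))%E.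
    exact: integrableB.
  by apply/funext => x /=; rewrite -EFinB subKr.
have iS (B : set T) (W : T -> R) : F B -> P.-integrable setT (EFin \o W) ->
    P.-integrable B (EFin \o W).
  by move=> FB; apply: integrableS => //; exact: Fm.
have iVl : P.-integrable setT (EFin \o (fun x => V x + l x)).
  exact: (integrableD measurableT iV il).
have iVl' : P.-integrable setT (EFin \o (fun x => V x - l x)).
  exact: (integrableB measurableT iV il).
have up : {ae P, forall x, Z x <= V x + l x}.
  apply: ae_le_of_integral => //; first exact: measurable_funD.
  move=> B FB; rewrite ZY//; apply: ae_le_integral; [exact: Fm|exact: iS..|].
  by apply: filterS YV => x; rewrite ler_norml => /andP[]; lra.
have lo : {ae P, forall x, V x - l x <= Z x}.
  apply: ae_le_of_integral => //; first exact: measurable_funB.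
  move=> B FB; rewrite ZY//; apply: ae_le_integral; [exact: Fm|exact: iS..|].
  by apply: filterS YV => x; rewrite ler_norml => /andP[]; lra.
by apply: filterS2 up lo => x up lo; rewrite ler_norml; apply/andP; split; lra.
Qed.

End conditional_comparison.

Section natural_filtration.
Context d (T : measurableType d) (R : realType).
Variable X : nat -> T -> R.
Hypothesis mX : forall t, measurable_fun setT (X t).

Lemma sigma_algebra_before n : sigma_algebra setT (sigma_before X n).
Proof. exact: smallest_sigma_algebra. Qed.

Lemma sigma_before_measurable n : sigma_before X n `<=` measurable.
Proof.
apply: smallest_sub; first exact: sigma_algebra_measurable.
apply: (big_ind (fun A : set (set T) => A `<=` measurable)).
- by [].
- by move=> A B Am Bm; rewrite subUset.
- by move=> i _ A [B mB <-]; exact: mX.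
Qed.

Lemma sigma_beforeS n : sigma_before X n `<=` sigma_before X n.+1.
Proof.
apply: (@sub_smallest2r _ (sigma_algebra setT)).
- exact: smallest_sigma_algebra.
- rewrite [X in _ `<=` X]big_ord_recr /=; exact: subsetUl.
Qed.

Lemma natural_filtrationE t : measurable_wrt (natural_filtration X t) (X t).
Proof.
move=> _ B mB; apply: sub_sigma_algebra; apply: sub_sigma_algebra.
by rewrite big_ord_recr /=; right; exists B.
Qed.

End natural_filtration.

(** * Integration against the transition kernels *)

Section integrable_of_fin_num.
Context d (T : measurableType d) (R : realType) (mu : {measure set T -> \bar R}).

(** A difference of nonnegative extended reals is finite only if both are: the
    other cases give [+oo], or [-oo] for [+oo - +oo]. *)
Lemma integrable_of_fin_num (f : T -> \bar R) : measurable_fun setT f ->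
  (\int[mu]_x f x)%E \is a fin_num -> mu.-integrable setT f.
Proof.
move=> mf; rewrite integralE => h.
have p0 : (0 <= \int[mu]_x f^\+ x)%E by apply: integral_ge0.
have n0 : (0 <= \int[mu]_x f^\- x)%E by apply: integral_ge0.
apply/integrableP; split => //.
rewrite -[X in (\int[mu]_x X x)%E](_ : f^\+ \+ f^\- = _)%E; last first.
  by rewrite -fune_abse.
rewrite ge0_integralD//; [|exact: measurable_funepos|exact: measurable_funeneg].
move: h p0 n0; case: (\int[mu]_x f^\+ x)%E => [p| |] //;
  case: (\int[mu]_x f^\- x)%E => [q| |] //=.
by rewrite -EFinD ltry.
Qed.

End integrable_of_fin_num.

Section transition.
Context d (T : measurableType d) (R : realType) (P : probability T R).
Variables (X : nat -> {RV P >-> R}) (K : nat -> nat -> R.-pker R ~> R).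
Hypotheses (markovX : markov_process X) (kernelX : transition_kernels X K).

Let Fm t : natural_filtration X t `<=` measurable.
Proof. by apply: sigma_before_measurable => i; exact: measurable_funPT. Qed.

Local Open Scope ereal_scope.

Lemma measurable_kernel_integral s t (h : R -> \bar R) :
  measurable_fun setT h -> (forall y, 0 <= h y) ->
  measurable_fun setT (fun x => \int[K s t x]_y h y).
Proof.
move=> mh h0; apply: measurable_fun_integral_kernel => // U mU.
exact: measurable_kernel.
Qed.

(** For an indicator [h] this is the definition of a version of the conditional
    probability, where the Markov property replaces [sigma(X_s)] by [F_s];
    functional induction gives the rest. *)
Lemma ge0_integral_transition s t (B : set T) (h : R -> \bar R) : (s <= t)%N ->
    natural_filtration X s B -> measurable_fun setT h -> (forall y, 0 <= h y) ->
  \int[P]_(w in B) h (X t w) = \int[P]_(w in B) \int[K s t (X s w)]_y h y.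
Proof.
move=> st FB; have mB : measurable B by exact: Fm FB.
have mXB i d' (T' : measurableType d') (g : R -> T') : measurable_fun setT g ->
    measurable_fun B (g \o X i).
  by move=> mg; apply: measurable_funTS; apply: measurableT_comp.
have mK g : measurable_fun setT g -> (forall y, 0 <= g y) ->
    measurable_fun B (fun w => \int[K s t (X s w)]_y g y).
  by move=> mg g0; apply: (mXB s _ _ (fun x => \int[K s t x]_y g y));
    exact: measurable_kernel_integral.
have K0 g w : (forall y, 0 <= g y) -> 0 <= \int[K s t (X s w)]_y g y.
  by move=> g0; exact: integral_ge0.
apply: (ge0_measurable_ind (Q := fun h => \int[P]_(w in B) h (X t w) =
  \int[P]_(w in B) \int[K s t (X s w)]_y h y)).
- rewrite [LHS]integral0; under eq_integral do rewrite integral0.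
  by rewrite integral0.
- move=> r A g r0 mA mg g0 IH.
  have m1 : measurable_fun setT (fun y : R => (\1_A y)%:E : \bar R).
    exact/measurable_EFinP.
  have r1 (y : R) : 0 <= r%:E * (\1_A y)%:E by rewrite mule_ge0// lee_fin.
  have mr1 : measurable_fun setT (fun y : R => r%:E * (\1_A y)%:E).
    exact: measurable_funeM.
  rewrite ge0_integralD//; [|exact: (mXB t _ _ _ mr1)|exact: (mXB t _ _ _ mg)].
  under [RHS]eq_integral do rewrite ge0_integralD//.
  rewrite ge0_integralD//; [|by move=> *; exact: K0|exact: mK|
    by move=> *; exact: K0|exact: mK].
  congr (_ + _); last exact: IH.
  rewrite ge0_integralZl_EFin//; last exact: (mXB t _ _ _ m1).
  under [RHS]eq_integral do rewrite ge0_integralZl_EFin// integral_indic// setIT.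
  rewrite ge0_integralZl_EFin//; last first.
    by apply: (mXB s _ _ (fun x => K s t x A)); exact: measurable_kernel.
  congr (_ * _).
  have [_ ->//] := markovX st mA (kernelX st mA).
  rewrite (_ : (fun w => (\1_A (X t w))%:E) = fun w => (\1_(X t @^-1` A) w)%:E)//.
  rewrite integral_indic//.
  by rewrite -[X in measurable X]setTI; exact: measurable_funPT.
- move=> g mg g0 ndg IH.
  rewrite (monotone_convergence P mB (g' := fun n w => g n (X t w)))//.
  + under [RHS]eq_integral do rewrite monotone_convergence//.
    rewrite (monotone_convergence P mB
      (g' := fun n w => \int[K s t (X s w)]_y g n y))//.
    * by congr (limn _); apply/funext => n.
    * by move=> n; exact: mK.
    * by move=> n w _; exact: K0.
    * by move=> w _ m n mn; apply: ge0_le_integral => // y _; exact: ndg.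
  + by move=> n; exact: (mXB t _ _ _ (mg n)).
Qed.

End transition.

(* Here [fine (\int[K s t x]_y (phi y)%:E)] is [E[phi (X t) | X s = x]]. *)
Section transition_real.
Context d (T : measurableType d) (R : realType) (P : probability T R).
Variables (X : nat -> {RV P >-> R}) (K : nat -> nat -> R.-pker R ~> R).
Hypotheses (markovX : markov_process X) (kernelX : transition_kernels X K).
Variables (s t : nat) (phi : R -> R).
Hypotheses (st : (s <= t)%N) (mphi : measurable_fun setT phi)
  (Kphi : forall x, (K s t x).-integrable setT (EFin \o phi))
  (iphi : P.-integrable setT (EFin \o (phi \o X t))).

Local Open Scope ereal_scope.

Let Fm i : natural_filtration X i `<=` measurable.
Proof. by apply: sigma_before_measurable => j; exact: measurable_funPT. Qed.

Let Phi x := \int[K s t x]_y (phi y)%:E.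

Let Ephi : R -> \bar R := EFin \o phi.

Let mEphi : measurable_fun setT Ephi. Proof. exact/measurable_EFinP. Qed.

Let PhiE x : Phi x = \int[K s t x]_y Ephi^\+ y - \int[K s t x]_y Ephi^\- y.
Proof. exact: integralE. Qed.

Let fin_Phi x : Phi x \is a fin_num.
Proof. exact: integrable_fin_num (Kphi x). Qed.

Let mK (h : R -> \bar R) : measurable_fun setT h -> (forall y, 0 <= h y) ->
  measurable_fun setT (fun w => \int[K s t (X s w)]_y h y).
Proof.
move=> mh h0; apply: (measurableT_comp (f := fun x => \int[K s t x]_y h y)) => //.
exact: measurable_kernel_integral.
Qed.

Lemma measurable_transition : measurable_fun setT
  (fun x => fine (\int[K s t x]_y (phi y)%:E)).
Proof.
apply: (measurableT_comp (f := fine)) => //.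
rewrite (_ : (fun x => _) = fun x =>
  \int[K s t x]_y Ephi^\+ y - \int[K s t x]_y Ephi^\- y); last exact/funext.
by apply: emeasurable_funB; apply: measurable_kernel_integral => //;
  [exact: measurable_funepos|exact: measurable_funeneg].
Qed.

Let integrable_half (h : R -> \bar R) : measurable_fun setT h ->
    (forall y, 0 <= h y) -> (forall y, h y <= `|Ephi y|) ->
  P.-integrable setT (fun w => \int[K s t (X s w)]_y h y).
Proof.
move=> mh h0 hphi; apply/integrableP; split; first exact: mK.
under eq_integral do rewrite gee0_abs ?integral_ge0//.
rewrite -(ge0_integral_transition markovX kernelX st _ mh h0); last first.
  exact: (@measurableT _ (g_sigma_algebraType _)).
have /integrableP[mphiX] := iphi; apply: le_lt_trans.
by apply: ge0_le_integral => //; [exact: measurableT_comp|exact: measurableT_comp].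
Qed.

Let pos_le y : Ephi^\+ y <= `|Ephi y|.
Proof. by rewrite -/((abse \o Ephi) y) fune_abse leeDl. Qed.

Let neg_le y : Ephi^\- y <= `|Ephi y|.
Proof. by rewrite -/((abse \o Ephi) y) fune_abse leeDr. Qed.

Let iPos : P.-integrable setT (fun w => \int[K s t (X s w)]_y Ephi^\+ y).
Proof. by apply: integrable_half => //; exact: measurable_funepos. Qed.

Let iNeg : P.-integrable setT (fun w => \int[K s t (X s w)]_y Ephi^\- y).
Proof. by apply: integrable_half => //; exact: measurable_funeneg. Qed.

Let finePhi w : (fine (\int[K s t (X s w)]_y (phi y)%:E))%:E =
  \int[K s t (X s w)]_y Ephi^\+ y - \int[K s t (X s w)]_y Ephi^\- y.
Proof. by rewrite fineK; [exact: PhiE|exact: fin_Phi (X s w)]. Qed.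

(** The integrals of [phi^+] and [phi^-] are at most that of [|phi|], whose mean
    along [X s] is [E|phi (X t)|]. *)
Lemma integrable_transition :
  P.-integrable setT
  (EFin \o (fun w => fine (\int[K s t (X s w)]_y (phi y)%:E))).
Proof.
apply: eq_integrable (integrableB measurableT iPos iNeg) => // w _ /=.
by rewrite finePhi.
Qed.

Lemma integral_transition (B : set T) : natural_filtration X s B ->
  \int[P]_(w in B) (fine (\int[K s t (X s w)]_y (phi y)%:E))%:E =
  \int[P]_(w in B) (phi (X t w))%:E.
Proof.
move=> FB; have mB : measurable B by exact: Fm FB.
under eq_integral do rewrite finePhi.
rewrite integralB//; [|by apply: integrableS iPos|by apply: integrableS iNeg].
rewrite -(ge0_integral_transition markovX kernelX st FB (h := Ephi^\+))//;
  last exact: measurable_funepos.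
rewrite -(ge0_integral_transition markovX kernelX st FB (h := Ephi^\-))//;
  last exact: measurable_funeneg.
rewrite [RHS]integralE; congr (_ - _); apply: eq_integral => w _.
  by rewrite !funeposE.
by rewrite !funenegE.
Qed.

End transition_real.

(** * The martingale of an additive functional *)

(** With [s] the sum, [s * k] is [1 - (1 - k) ^+ (n - t)]. The truncated
    subtraction covers the empty sum [n <= t]. *)
Lemma geometric_tail_le (R : realFieldType) (k : R) t n : 0 < k -> k < 1 ->
  \sum_(1 <= u < n.+1 | (t < u)%N) (1 - k) ^+ (u - t.+1) <= k^-1.
Proof.
move=> k0 k1; set s := \sum_(_ <= _ < _ | _) _.
suff sk : s * k = 1 - (1 - k) ^+ (n - t).
  rewrite -[leRHS]mul1r ler_pdivlMr// sk.
  by rewrite lerBlDl lerDr exprn_ge0// subr_ge0 ltW.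
rewrite {}/s; elim: n => [|n IHn].
  by rewrite big_geq// mul0r sub0n expr0 subrr.
rewrite big_mkcond big_nat_recr//= -big_mkcond/= mulrDl IHn ltnS.
have [tn|nt] := leqP t n.
  by rewrite subSS subSn// exprS; ring.
have -> : (n - t = 0)%N by apply/eqP; rewrite subn_eq0 ltnW.
have -> : (n.+1 - t = 0)%N by apply/eqP; rewrite subn_eq0.
by rewrite mul0r addr0.
Qed.

Lemma ae_le_measure d (T : measurableType d) (R : realType)
    (mu : {measure set T -> \bar R}) (A B : set T) :
  measurable A -> measurable B -> {ae mu, forall x, A x -> B x} ->
  (mu A <= mu B)%E.
Proof.
move=> mA mB [N [mN N0 AB]]; rewrite -[leRHS]adde0 -[X in (_ + X)%E]N0.
apply: le_trans (measureU2 mu mB mN).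
apply: le_measure; [exact/mem_set|apply/mem_set; exact: measurableU|].
move=> x Ax; have [Bx|nBx] := pselect (B x); [by left|right].
by apply: AB => /(_ Ax).
Qed.

Section martingale.
Context (R : realType) d (Omega : measurableType d) (P : probability Omega R).
Variables (X : nat -> {RV P >-> R}) (x0 : R) (K : nat -> nat -> R.-pker R ~> R)
  (f : nat * R -> R) (C kappa sigma : nat -> Omega -> R).
Hypotheses (markovX : markov_process X) (kernelX : transition_kernels X K)
  (X0 : {ae P, forall w, X 0%N w = x0})
  (mf : measurable_fun [set: nat * R] f)
  (bpC : bounded_predictable P X C)
  (bpkappa : bounded_predictable P X kappa)
  (bpsigma : bounded_predictable P X sigma)
  (C_gt0 : forall t, {ae P, forall w, 0 < C t w})
  (kappa_gt0 : forall t, {ae P, forall w, 0 < kappa t w})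
  (sigma_gt0 : forall t, {ae P, forall w, 0 < sigma t w})
  (kappa_lt1 : forall t, {ae P, forall w, kappa t w < 1})
  (step_le : forall t, (1 <= t)%N ->
     {ae P, forall w, `|X t w - X t.-1 w| <= C t w})
  (lipschitz_le : forall s t, (s <= t)%N ->
     {ae P, forall w, forall x y : R,
       (`|transition_op K f s t x - transition_op K f s t y|
         <= (sigma s w * (1 - kappa s w) ^+ (t - s) * `|x - y|)%:E)%E}).

Let F := natural_filtration X.

Let sF t : sigma_algebra setT (F t).
Proof. exact: sigma_algebra_before. Qed.

Let Fm t : F t `<=` measurable.
Proof. by apply: sigma_before_measurable => j; exact: measurable_funPT. Qed.

Let ndF t : F t `<=` F t.+1.
Proof. exact: sigma_beforeS. Qed.

Let phi t y := f (t, y).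

Let mphi t : measurable_fun setT (phi t).
Proof. exact: measurableT_comp mf (pair1_measurable t). Qed.

(** The Lipschitz bound at [x = y] says that the difference of the value with
    itself is finite, and an infinite value minus itself is [-oo]. *)
Lemma transition_op_fin_num s t x : (s <= t)%N ->
  transition_op K f s t x \is a fin_num.
Proof.
move=> st; have : ProperFilter (almost_everywhere P).
  have P0 : (0 < P [set: Omega])%E by rewrite probability_setT.
  exact: ae_properfilter_algebraOfSetsType.
move=> PF; have [w /(_ x x)] := filter_ex (lipschitz_le st).
by case: (transition_op K f s t x) => [p| |].
Qed.

Let iK s t x : (s <= t)%N -> (K s t x).-integrable setT (EFin \o phi t).
Proof.
move=> st; apply: integrable_of_fin_num; first exact/measurable_EFinP.
exact: transition_op_fin_num.
Qed.

(** The law of [X t] is [K 0 t x0], as [X 0] is almost surely [x0], and [phi t] is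
    integrable for every measure [K 0 t x]. *)
Lemma chain_integrable t :
  P.-integrable setT (EFin \o (phi t \o X t)).
Proof.
apply/integrableP; split.
  by apply/measurable_EFinP; exact: measurableT_comp.
have m : measurable_fun setT (fun y => `|(phi t y)%:E|)%E.
  by apply: measurableT_comp => //; exact/measurable_EFinP.
rewrite (ge0_integral_transition markovX kernelX (leq0n t) _ m)//; last first.
  exact: (@measurableT _ (g_sigma_algebraType _)).
have Kx0 : (\int[K 0%N t x0]_y `|(phi t y)%:E| < +oo)%E.
  by have /integrableP[] := iK x0 (leq0n t).
rewrite (ae_eq_integral (cst (\int[K 0%N t x0]_y `|(phi t y)%:E|)%E))//.
- rewrite integral_cst// ltey_eq fin_numM ?fin_num_measure//.
  by rewrite ge0_fin_numE// integral_ge0.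
- apply: (measurableT_comp (f := fun x => \int[K 0%N t x]_y `|(phi t y)%:E|)%E) => //.
  exact: measurable_kernel_integral.
- by apply: filterS X0 => w -> _.
Qed.

Let g s t x := fine (transition_op K f s t x).

Let gE s t x : (s <= t)%N -> (g s t x)%:E = transition_op K f s t x.
Proof. by move=> st; rewrite fineK// transition_op_fin_num. Qed.

Let mg s t : measurable_fun setT (g s t).
Proof. exact: (measurable_transition K s t (@mphi t)). Qed.

Let mgX s t : measurable_wrt (F s) (fun w => g s t (X s w)).
Proof.
apply: (measurableT_comp (f := g s t)) => //.
exact: (natural_filtrationE (X := X)).
Qed.

Let igX s t : (s <= t)%N -> P.-integrable setT (EFin \o (fun w => g s t (X s w))).
Proof.
move=> st; apply: (integrable_transition markovX kernelX st (@mphi t)).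
  by move=> x; exact: iK.
exact: chain_integrable.
Qed.

Let integral_gX s t (B : set Omega) : (s <= t)%N -> F s B ->
  (\int[P]_(w in B) (g s t (X s w))%:E = \int[P]_(w in B) (phi t (X t w))%:E)%E.
Proof.
move=> st FB; apply: (integral_transition markovX kernelX st (@mphi t)) => //.
  by move=> x; exact: iK.
exact: chain_integrable.
Qed.

Let lipg s t : (s <= t)%N -> {ae P, forall w, forall x y,
  `|g s t x - g s t y| <= sigma s w * (1 - kappa s w) ^+ (t - s) * `|x - y|}.
Proof.
move=> st; apply: filterS (lipschitz_le st) => w h x y.
by have := h x y; rewrite -!gE// -EFinB lee_fin.
Qed.

(** Both sides are known at time [t] and have the same integral over each event
    of [F t]. *)
Let g_diag t : {ae P, forall w, g t t (X t w) = phi t (X t w)}.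
Proof.
have mp : measurable_wrt (F t) (fun w => phi t (X t w)).
  apply: (measurableT_comp (f := phi t)) => //.
  exact: (natural_filtrationE (X := X)).
have ip := chain_integrable t.
have ig := igX (leqnn t).
have le1 : {ae P, forall w, g t t (X t w) <= phi t (X t w)}.
  apply: (ae_le_of_integral (@sF t) (@Fm t) (@mgX t t) mp ig ip).
  by move=> B FB; rewrite integral_gX.
have le2 : {ae P, forall w, phi t (X t w) <= g t t (X t w)}.
  apply: (ae_le_of_integral (@sF t) (@Fm t) mp (@mgX t t) ip ig).
  by move=> B FB; rewrite integral_gX.
by apply: filterS2 le1 le2 => w l1 l2; apply/eqP; rewrite eq_le l1 l2.
Qed.

(** The bound on the change of [g t.+1 u] when its argument moves from [X t] to
    [X t.+1]. *)
Let l t u w := sigma t.+1 w * C t.+1 w * (1 - kappa t.+1 w) ^+ (u - t.+1).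

Let ml t u : measurable_wrt (F t) (l t u).
Proof.
apply: measurable_funM.
  by apply: measurable_funM; [exact: (bpsigma t.+1).1|exact: (bpC t.+1).1].
apply: measurable_funX; apply: measurable_funB => //.
exact: (bpkappa t.+1).1.
Qed.

Let l_bounded t : exists A : R, forall u, {ae P, forall w, `|l t u w| <= A}.
Proof.
have [_ [A sA]] := bpsigma t.+1; have [_ [B CB]] := bpC t.+1.
exists (A * B) => u.
have k0 := kappa_gt0 t.+1; have k1 := kappa_lt1 t.+1.
apply: filterS2 (filterI sA CB) (filterI k0 k1) => w [wA wB] [w0 w1].
rewrite /l !normrM normrX -[leRHS]mulr1 ler_pM ?mulr_ge0 ?exprn_ge0 ?ler_pM//.
by rewrite exprn_ile1// ger0_norm; lra.
Qed.

(** The factor [2] comes from comparing both values of [g] with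
    [g t.+1 u (X t)], which is known at time [t]. *)
Let g_step t u : (t < u)%N -> {ae P, forall w,
  `|g t.+1 u (X t.+1 w) - g t u (X t w)| <= 2 * l t u w}.
Proof.
move=> tu.
have Vclose : {ae P, forall w,
    `|g t.+1 u (X t.+1 w) - g t.+1 u (X t w)| <= l t u w}.
  apply: filterS2 (filterI (lipg tu) (step_le (ltn0Sn t)))
    (filterI (filterI (sigma_gt0 t.+1) (kappa_lt1 t.+1)) (C_gt0 t.+1)) =>
    w [lw sw] [[s0 k1] C0].
  apply: (le_trans (lw _ _)); rewrite /l [leRHS]mulrAC ler_wpM2l//.
  by rewrite mulr_ge0 ?exprn_ge0 ?ltW// subr_gt0.
have Zclose : {ae P, forall w, `|g t u (X t w) - g t.+1 u (X t w)| <= l t u w}.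
  have mV : measurable_wrt (F t) (fun w => g t.+1 u (X t w)).
    apply: (measurableT_comp (f := g t.+1 u)) => //.
    exact: (natural_filtrationE (X := X)).
  apply: (cond_exp_close (@sF t) (@Fm t) (@mgX t u) mV (@ml t u)
    (igX tu) (igX (ltnW tu)) _ _ Vclose).
  - move=> B FB; rewrite !integral_gX//; first exact: ndF.
    exact: ltnW.
  - by have [A bA] := l_bounded t; exists A.
apply: filterS2 Vclose Zclose => w; rewrite !ler_norml => /andP[? ?] /andP[? ?].
by apply/andP; split; lra.
Qed.

Variable n : nat.

(** The martingale [E[f (u, X_u) | F_t]]; the minimum freezes it from time [u]
    on. *)
Let Y t u w := g (minn t u) u (X (minn t u) w).

Let M t w := \sum_(1 <= u < n.+1) Y t u w.

(** Kept as a finite sum rather than [sigma C / kappa], which need not be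
    bounded as [kappa] may come close to [0]. *)
Let L t w := \sum_(1 <= u < n.+1) if (t < u)%N then l t u w else 0.

Let mM t : measurable_wrt (F t) (M t).
Proof.
apply: measurable_sum => u.
exact: (measurable_wrt_le ndF (geq_minl t u) (@mgX (minn t u) u)).
Qed.

Let iY t u : P.-integrable setT (EFin \o Y t u).
Proof. exact: (igX (geq_minr t u)). Qed.

Let EFin_M t : EFin \o M t = (fun w => \sum_(1 <= u < n.+1) (Y t u w)%:E)%E.
Proof. by apply/funext => w; rewrite /= sumEFin. Qed.

Let iM t : P.-integrable setT (EFin \o M t).
Proof.
rewrite EFin_M.
by apply: (integrable_sum measurableT _ (h := fun u => EFin \o Y t u)).
Qed.

Let martM t B : F t B ->
  (\int[P]_(w in B) (M t.+1 w)%:E = \int[P]_(w in B) (M t w)%:E)%E.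
Proof.
move=> FB; have mB : measurable B by exact: Fm FB.
have iYB s u : P.-integrable B (EFin \o Y s u) by apply: integrableS (iY s u).
have intM s : (\int[P]_(w in B) (M s w)%:E =
    \sum_(1 <= u < n.+1) \int[P]_(w in B) (Y s u w)%:E)%E.
  rewrite -(integral_sum mB (f := fun u => EFin \o Y s u))//.
  by apply: eq_integral => w _; rewrite -sumEFin.
rewrite !intM; apply: eq_bigr => u _; rewrite /Y.
have [tu|ut] := ltnP t u; last by rewrite (minn_idPr (leqW ut)).
rewrite (minn_idPl tu) (integral_gX tu (ndF FB)) (integral_gX (ltnW tu) FB).
by [].
Qed.

Let mL t : measurable_wrt (F t) (L t).
Proof.
apply: measurable_sum => u; case: (t < u)%N; first exact: (@ml t u).
exact: measurable_cst.
Qed.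

Let L_bounded t : exists A : R, {ae P, forall w, `|2 * L t w| <= A}.
Proof.
have [A lA] := l_bounded t; exists (2 * \sum_(1 <= u < n.+1) `|A|).
apply: filterS (ae_foralln lA) => w lw; rewrite normrM ger0_norm// ler_wpM2l//.
apply: (le_trans (ler_norm_sum _ _ _)); apply: ler_sum => u _.
by case: ifP => _; [rewrite (le_trans (lw u)) ?ler_norm|rewrite normr0].
Qed.

Let M_step t : {ae P, forall w, `|M t.+1 w - M t w| <= 2 * L t w}.
Proof.
have h u : {ae P, forall w,
    `|Y t.+1 u w - Y t u w| <= 2 * if (t < u)%N then l t u w else 0}.
  have [tu|ut] := ltnP t u; last first.
    apply: aeW => w.
    by rewrite /Y (minn_idPr ut) (minn_idPr (leqW ut)) subrr normr0 mulr0.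
  apply: filterS (g_step tu) => w.
  by rewrite /Y (minn_idPl tu) (minn_idPl (ltnW tu)).
apply: filterS (ae_foralln h) => w hw.
rewrite /M /L -sumrB mulr_sumr; apply: (le_trans (ler_norm_sum _ _ _)).
exact: ler_sum.
Qed.

Let M0 : {ae P, forall w, M 0%N w = \sum_(1 <= u < n.+1) g 0%N u x0}.
Proof.
by apply: filterS X0 => w Xw; apply: eq_bigr => u _; rewrite /Y min0n Xw.
Qed.

Let Mn : {ae P, forall w, M n w = additive_functional f X n w}.
Proof.
apply: filterS (ae_foralln g_diag) => w gw; apply: eq_big_nat => u /andP[_ un].
by rewrite /Y (minn_idPr _)// gw.
Qed.

Let mS : measurable_fun setT (additive_functional f X n).
Proof.
by apply: measurable_sum => u; apply: (measurableT_comp (f := phi u)).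
Qed.

Let expectation_S :
  ('E_P[additive_functional f X n] = (\sum_(1 <= u < n.+1) g 0%N u x0)%:E)%E.
Proof.
rewrite unlock (ae_eq_integral (EFin \o M n))//; last 3 first.
- exact/measurable_EFinP.
- exact: measurable_int (iM n).
- by apply: filterS Mn => w /= ->.
have -> k : (\int[P]_w (EFin \o M k) w = \int[P]_w (M 0%N w)%:E)%E.
  elim: k => // k <-; apply: martM.
  exact: (@measurableT _ (g_sigma_algebraType _)).
rewrite (ae_eq_integral (cst (\sum_(1 <= u < n.+1) g 0%N u x0)%:E))//.
- by rewrite integral_cst// [X in (_ * X)%E]probability_setT mule1.
- exact: measurable_int (iM 0%N).
- by apply: filterS M0 => w /= ->.
Qed.

Let sum_L_le (a : R) : {ae P, forall w,
  \sum_(1 <= t < n.+1) (sigma t w ^+ 2 * C t w ^+ 2 / kappa t w ^+ 2) <= a ^+ 2 ->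
  \sum_(0 <= t < n) (2 * L t w) ^+ 2 <= (2 * a) ^+ 2}.
Proof.
apply: filterS2 (filterI (ae_foralln C_gt0) (ae_foralln sigma_gt0))
  (filterI (ae_foralln kappa_gt0) (ae_foralln kappa_lt1)) =>
  w [C0 s0] [k0 k1] sa.
have -> : (2 * a) ^+ 2 = 4 * a ^+ 2 by ring.
apply: (@le_trans _ _ (4 * \sum_(1 <= t < n.+1)
    (sigma t w ^+ 2 * C t w ^+ 2 / kappa t w ^+ 2))); last by rewrite ler_pM2l.
rewrite big_add1 /= mulr_sumr; apply: ler_sum => t _.
have Lle : L t w <= sigma t.+1 w * C t.+1 w / kappa t.+1 w.
  have -> : L t w = sigma t.+1 w * C t.+1 w *
      \sum_(1 <= u < n.+1 | (t < u)%N) (1 - kappa t.+1 w) ^+ (u - t.+1).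
    by rewrite mulr_sumr big_mkcond.
  by rewrite ler_pM2l ?mulr_gt0//; exact: geometric_tail_le.
have L0 : 0 <= L t w.
  apply: sumr_ge0 => u _; case: ifP => // _.
  by rewrite /l !mulr_ge0 ?exprn_ge0 ?ltW// subr_gt0.
have -> : 4 * (sigma t.+1 w ^+ 2 * C t.+1 w ^+ 2 / kappa t.+1 w ^+ 2) =
    (2 * (sigma t.+1 w * C t.+1 w / kappa t.+1 w)) ^+ 2.
  by field; rewrite gt_eqF.
have B0 := le_trans L0 Lle.
by apply: lerXn2r; [exact: mulr_ge0|exact: mulr_ge0|rewrite ler_pM2l].
Qed.

Lemma additive_functional_concentration (r a : R) : 0 < r -> 0 < a ->
  (P [set w |
      (r%:E <= (additive_functional f X n w)%:E
               - 'E_P[additive_functional f X n])%E /\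
      (\sum_(1 <= t < n.+1)
         (sigma t w ^+ 2 * C t w ^+ 2 / kappa t w ^+ 2) <= a ^+ 2)%R]
   <= (expR (- (r ^+ 2 / (8 * a ^+ 2))))%:E)%E.
Proof.
move=> r0 a0.
have a20 : 0 < 2 * a by rewrite mulr_gt0.
have := azuma_predictable sF Fm ndF mM iM martM
  (fun t => measurable_funM (measurable_cst _) (@mL t)) L_bounded M_step n r0 a20.
have -> : 2 * (2 * a) ^+ 2 = 8 * a ^+ 2 by ring.
apply: le_trans; rewrite expectation_S.
set m := \sum_(1 <= u < n.+1) g 0%N u x0.
have mwrt (Z : nat -> Omega -> R) t : bounded_predictable P X Z ->
    measurable_fun setT (Z t).
  move=> bpZ; apply: (measurable_sub_sigma (F := sigma_before X t)).
    by apply: sigma_before_measurable => j; exact: measurable_funPT.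
  exact: (bpZ t).1.
have mLt t : measurable_fun setT (L t) := measurable_sub_sigma (@Fm t) (@mL t).
have mMt t : measurable_fun setT (M t) := measurable_sub_sigma (@Fm t) (@mM t).
apply: ae_le_measure.
- apply: measurableI.
    rewrite [X in measurable X](_ : _ = [set w | r <= additive_functional f X n w - m]).
      rewrite -[X in measurable X]setTI; apply: measurable_fun_ler => //.
      exact: measurable_funB.
    by apply/seteqP; split => w /=; rewrite -EFinB lee_fin.
  rewrite -[X in measurable X]setTI; apply: measurable_fun_ler => //.
  apply: measurable_sum => t; apply: measurable_funM.
    by apply: measurable_funM; apply: measurable_funX; exact: mwrt.
  apply: (measurableT_comp (@measurable_invr R)).
  by apply: measurable_funX; exact: mwrt.
- apply: measurableI; rewrite -[X in measurable X]setTI;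
    apply: measurable_fun_ler => //; first exact: measurable_funB.
  by apply: measurable_sum => t; apply: measurable_funX; exact: measurable_funM.
- apply: filterS3 M0 Mn (sum_L_le a) => w M0w Mnw Lw [rS /Lw Lw'].
  by split => //=; rewrite M0w Mnw; move: rS; rewrite -EFinB lee_fin.
Qed.

End martingale.

Theorem proposition2p12 (R : realType) (d : measure_display)
  (Omega : measurableType d) (P : probability Omega R)
  (X : nat -> {RV P >-> R}) (x0 : R)
  (K : nat -> nat -> R.-pker R ~> R)
  (f : nat * R -> R) (C kappa sigma : nat -> Omega -> R)
  (markovX : markov_process X)
  (kernelX : transition_kernels X K)
  (X0 : {ae P, forall w, X 0%N w = x0})
  (mf : measurable_fun [set: nat * R] f)
  (bpC : bounded_predictable P X C)
  (bpkappa : bounded_predictable P X kappa)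
  (bpsigma : bounded_predictable P X sigma)
  (C_gt0 : forall t, {ae P, forall w, 0 < C t w})
  (kappa_gt0 : forall t, {ae P, forall w, 0 < kappa t w})
  (sigma_gt0 : forall t, {ae P, forall w, 0 < sigma t w})
  (kappa_lt1 : forall t, {ae P, forall w, kappa t w < 1})
  (step_le : forall t, (1 <= t)%N ->
     {ae P, forall w, `|X t w - X t.-1 w| <= C t w})
  (lipschitz_le : forall s t, (s <= t)%N ->
     {ae P, forall w, forall x y : R,
       (`|transition_op K f s t x - transition_op K f s t y|
         <= (sigma s w * (1 - kappa s w) ^+ (t - s) * `|x - y|)%:E)%E}) :
  forall (n : nat) (r a : R), (0 < n)%N -> 0 < r -> 0 < a ->
    (P [set w |
        (r%:E <= (additive_functional f X n w)%:E
                 - 'E_P[additive_functional f X n])%E /\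
        (\sum_(1 <= t < n.+1)
           (sigma t w ^+ 2 * C t w ^+ 2 / kappa t w ^+ 2) <= a ^+ 2)%R]
     <= (expR (- (r ^+ 2 / (8 * a ^+ 2))))%:E)%E.
Proof.
move=> n r a _ r0 a0.
exact: (additive_functional_concentration markovX kernelX X0 mf bpC bpkappa
  bpsigma C_gt0 kappa_gt0 sigma_gt0 kappa_lt1 step_le lipschitz_le).
Qed.
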